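(* Let $d\in\{1,2,3\}$ and consider the $d$-dimensional special relativistic hydrodynamics (RHD) system with an equation of state $h=h(\theta)=1+e(\theta)+\theta$, $\theta=p/\rho$, satisfying $$e'(\theta)>0,\qquad h(\theta)>\frac{\theta\,(1+e'(\theta))}{e'(\theta)}\qquad\text{for all }\theta>0 .$$ Define $S:=-\ln\rho+\int^{\theta}\frac{e'(x)}{x}\,dx$ and $\eta(\mathbf U):=-DS$. Then $\eta$ is strictly convex with respect to the conservative variables $\mathbf U$ for $\mathbf U\in\mathcal G$, where $$\mathcal G=\{\mathbf U=(D,\mathbf m^\top,E)^\top:\ \rho>0,\ \theta>0\}.$$
   Context: The conservative variables are $\mathbf U=(D,\mathbf m^\top,E)^\top\in\mathbb R^{d+2}$ with $D=\rho\gamma$, $\mathbf m=\rho h\gamma^2\mathbf v$, $E=\rho h\gamma^2-p$, where $\rho$ is the rest-mass density, $p$ the pressure, $\mathbf v\in\mathbb R^d$ with $|\mathbf v|<1$ the velocity, $\gamma=(1-|\mathbf v|^2)^{-1/2}$ the Lorentz factor, $h$ the specific enthalpy, $e$ the specific internal energy, and $\theta:=p/\rho$. The RHD system is $\partial_t\mathbf U+\sum_{i=1}^d\partial_{x_i}\mathbf F_i(\mathbf U)=\mathbf 0$ with $\mathbf F_i(\mathbf U)=(Dv_i,\ v_i\mathbf m^\top+p\,\mathbf e_i^\top,\ m_i)^\top$, $\mathbf e_i$ being the $i$-th column of the $d\times d$ identity matrix. The equation of state is of ''Synge type'': $h=1+e(\theta)+\theta$ with $e$ continuously differentiable on $(0,\infty)$.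 $\int^\theta \frac{e'(x)}{x}dx$ denotes a fixed antiderivative of $e'(\theta)/\theta$. $S$ and $\eta$ are explicit functions of the primitive variables $(\rho,\mathbf v,p)$ and are regarded as functions of $\mathbf U$ through the correspondence between $(\rho,\mathbf v,p)$ and $\mathbf U$. $\mathcal G$ is thus the set of all $\mathbf U$ arising from primitive variables with $\rho>0$, $p>0$, $|\mathbf v|<1$. Strict convexity is understood as positive definiteness of the Hessian $\partial^2\eta/\partial\mathbf U^2$. *)

(* Defs.v *)
(* MathComp / MathComp-Analysis *)
From mathcomp Require Import all_boot all_order all_algebra.
From mathcomp Require Import all_classical all_reals all_analysis.

Set Implicit Arguments.
Unset Strict Implicit.
Unset Printing Implicit Defensive.

Import Order.TTheory GRing.Theory Num.Theory.
Import numFieldNormedType.Exports.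

Local Open Scope classical_set_scope.
Local Open Scope ring_scope.

Section strict_convexity.
Context {R : realType} {n : nat}.
Implicit Types (f : 'rV[R]_n -> R) (x : 'rV[R]_n).

Definition partial f (j : 'I_n) x : R := 'D_(delta_mx 0 j) f x.

Definition hessian f x : 'M[R]_n :=
  \matrix_(i, j) partial (partial f j) i x.

(* 'D is a total operator with a default value where the limit does not exist;
   this guarantees that the entries of the Hessian are genuine derivatives. *)
Definition twice_differentiable f x : Prop :=
  (\forall y \near x, differentiable f y) /\
  (forall j, differentiable (partial f j) x).

Definition posdefmx (A : 'M[R]_n) : Prop :=
  A^T = A /\ forall x, x != 0 -> 0 < (x *m A *m x^T) 0 0.

Definition hessian_strictly_convex (G : set 'rV[R]_n) f : Prop :=
  forall x, G x -> twice_differentiable f x /\ posdefmx (hessian f x).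

End strict_convexity.

Section rhd.
Context {R : realType} {d : nat}.

(* Primitive variables (rho, v, p). *)
Definition prim : Type := (R * 'rV[R]_d * R)%type.

Implicit Types w : prim.

Definition rho w : R := w.1.1.
Definition vel w : 'rV[R]_d := w.1.2.
Definition prs w : R := w.2.
Definition theta w : R := prs w / rho w.

(* Not `|v|, which is the sup norm on row vectors. *)
Definition eucl_norm (v : 'rV[R]_d) : R := Num.sqrt (\sum_i v 0 i ^+ 2).

Definition lorentz w : R := (Num.sqrt (1 - eucl_norm (vel w) ^+ 2))^-1.

Definition admissible : set prim :=
  [set w | [/\ 0 < rho w, 0 < theta w & eucl_norm (vel w) < 1]].

(* The equation of state is given by the internal energy e as a function of
   theta; Ie stands for an antiderivative of e'(x) / x on (0, +oo). *)
Variables e Ie : R -> R.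

Definition enthalpy (t : R) : R := 1 + e t + t.

Definition cons_D w : R := rho w * lorentz w.

Definition cons_m w : 'rV[R]_d :=
  (rho w * enthalpy (theta w) * lorentz w ^+ 2) *: vel w.

Definition cons_E w : R :=
  rho w * enthalpy (theta w) * lorentz w ^+ 2 - prs w.

Definition cons w : 'rV[R]_(1 + (d + 1)) :=
  row_mx (cons_D w)%:M (row_mx (cons_m w) (cons_E w)%:M).

Definition consG : set 'rV[R]_(1 + (d + 1)) := cons @` admissible.

(* On consG, an admissible preimage under cons; a dummy value elsewhere. *)
Definition prim_of : 'rV[R]_(1 + (d + 1)) -> prim := pinv admissible cons.

Definition entropyS w : R := - ln (rho w) + Ie (theta w).

Definition eta (U : 'rV[R]_(1 + (d + 1))) : R :=
  - (cons_D (prim_of U) * entropyS (prim_of U)).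

End rhd.

Arguments consG {R} d e.
Arguments eta {R} d e Ie U.

(* Main.v *)
From HB Require Import structures.
Require Import Defs.
From mathcomp Require Import all_boot all_order all_algebra.
From mathcomp Require Import all_classical all_reals all_analysis.
From mathcomp Require Import ring lra.
Import Order.TTheory GRing.Theory Num.Theory.
Import numFieldNormedType.Exports.
Local Open Scope ring_scope.
Local Open Scope classical_set_scope.
Set Implicit Arguments.
Unset Strict Implicit.
Unset Printing Implicit Defensive.

(** The entropy [eta] is the Legendre transform of an explicit function of the
    entropy variables
<<
      W = (h / theta - S, gamma v / theta, - gamma / theta) =: (w0, b, - b0).
>>
    When the fluid state runs over all admissible ones, [W] runs over the
    product of the real line and the forward light cone [b0 > |b|], which is
    open and convex.  In these variables, with [s = b0 ^ 2 - |b| ^ 2], the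
    thermodynamics is explicit:
<<
      theta = s ^ (- 1 / 2),    p = exp (w0 + K theta),
      K theta = int (e' / x) - h / theta + ln theta,    K' = h / theta ^ 2.
>>
    The function [phi W = b0 p], whose value is the density [D], has gradient
    [U], and [eta U = W . U - phi W].  So the gradient of [eta] at [U] is [W],
    and the Hessian of [eta] is the inverse matrix of the Hessian of [phi]; it
    suffices that the latter be positive definite on the cone.

    Two steps carry the proof.

    The Legendre duality is [legendre_strictly_convex].  It has to produce the
    derivatives of [eta], hence those of the inverse of [W |-> U].  This map
    is injective because its differential is positive definite on a convex set
    ([monotone_injective]), it is open ([local_surjectivity]), so its inverse
    is continuous, and then differentiable ([is_diff_inverse]).

    The positivity is [entropy_form_eq0].  Splitting a direction into its part
    along [(b, b0)] and its Minkowski-orthogonal part reduces the Hessian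
    of [phi] to a quadratic form in the time components of the two parts,
<<
      e' X ^ 2 - 2 X Y + (h / theta - 1) Y ^ 2,
>>
    up to nonnegative terms.  As [e' > 0], it is positive definite if and only
    if [e' (h / theta - 1) > 1], and this is the assumed inequality
    [h > theta (1 + e') / e'] ([enthalpy_gap]). *)

(** * Differentials and row vectors *)

Section differential.
Context {R : realType} {V W : normedModType R}.

Lemma differentiable_approx (f : V -> W) x : differentiable f x ->
  forall eps, 0 < eps ->
  \forall y \near x, `|f y - f x - 'd f x (y - x)| <= eps * `|y - x|.
Proof.
move=> df eps eps0; have /diff_locally/eqaddoP/(_ _ eps0) := df.
move=> /= H; rewrite [\forall y \near x, _](near_shift 0).
by apply: filterS H => y; rewrite /= !fctE /= subr0 addrK opprD addrA.
Qed.

(** The [eps]-form of differentiability; it lets the derivative of an inverse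
    function be verified by estimates. *)
Lemma is_diff_approx (f : V -> W) (df : {linear V -> W}) x : continuous df ->
  (forall eps, 0 < eps ->
     \forall y \near x, `|f y - f x - df (y - x)| <= eps * `|y - x|) ->
  is_diff x f df.
Proof.
move=> dfc H.
have E : f \o shift x = cst (f x) + df +o_ 0 id.
  apply/eqaddoP => eps /H {}H; move: H.
  rewrite [\forall y \near x, _](near_shift 0).
  by apply: filterS => y; rewrite /= !fctE /= subr0 addrK opprD addrA.
have dE := diff_unique dfc E.
by apply: DiffDef => //; apply/diff_locallyP; rewrite dE.
Qed.

(** Differentiability is local: it passes from an explicit formula valid on an
    open set to a function defined by choice that agrees with it there. *)
Lemma near_is_diff (f g df : V -> W) x : (\forall y \near x, f y = g y) ->
  is_diff x f df -> is_diff x g df.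
Proof.
move=> fg [fx <-].
have dfc : continuous ('d f x) by exact: diff_continuous.
apply: is_diff_approx => // eps eps0; have fgx := nbhs_singleton fg.
by apply: filterS2 fg (differentiable_approx fx eps0) => y <-; rewrite -fgx.
Qed.

End differential.

Section row_vectors.
Context {R : realType}.

(** A linear map is the sum over [j] of the [j]-th coordinate times the image of
    the [j]-th basis vector. *)
Lemma linear_continuous_rV n (W : normedModType R) (f : {linear 'rV[R]_n -> W}) :
  continuous f.
Proof.
have -> : (f : _ -> W) = \sum_(j < n) (fun u : 'rV[R]_n => u 0 j *: f (delta_mx 0 j)).
  apply/funext => u; rewrite fct_sumE [in LHS](row_sum_delta u) linear_sum.
  by apply: eq_bigr => j _; rewrite linearZ.
move=> u; apply: differentiable_continuous; apply: differentiable_sum => j.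
exact/differentiableZl/differentiable_coord.
Qed.

Lemma is_diff_linear_rV n (W : normedModType R) (f : {linear 'rV[R]_n -> W}) x :
  is_diff x f f.
Proof.
have fc : continuous f by exact: linear_continuous_rV.
by apply: DiffDef; [exact: linear_differentiable|exact: diff_lin].
Qed.

Lemma is_diff_coord n (j : 'I_n) (x : 'rV[R]_n) :
  is_diff x (fun u : 'rV[R]_n => u 0 j : R) (fun u => u 0 j).
Proof.
have lc : linear (fun u : 'rV[R]_n => u 0 j : R) by move=> a u v; rewrite !mxE.
pose M := GRing.isLinear.Build _ _ _ _ _ lc.
pose L : {linear 'rV[R]_n -> R} := HB.pack (fun u : 'rV[R]_n => u 0 j : R) M.
exact: (is_diff_linear_rV L).
Qed.

Lemma is_diff_rV (V : normedModType R) n (f : V -> 'rV[R]_n)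
    (df : 'I_n -> V -> R) x :
  (forall j, is_diff x (fun y => f y 0 j) (df j)) ->
  is_diff x f (fun k => \row_j df j k).
Proof.
move=> fj.
have fE : f = \sum_(j < n) (fun y => f y 0 j *: delta_mx 0 j).
  by apply/funext => y; rewrite fct_sumE [LHS]row_sum_delta.
have df_ : differentiable f x.
  rewrite fE; apply: differentiable_sum => j.
  by apply: differentiableZl; apply: ex_diff.
apply: DiffDef => //; apply/funext => k; apply/rowP => j; rewrite mxE.
have /differentiableP fx := df_.
have := is_diff_comp fx (is_diff_coord j (f x)) => H.
have <- := @diff_val _ _ _ _ _ _ _ (fj j).
by rewrite [X in _ = X k](@diff_val _ _ _ _ _ _ _ H).
Qed.

Lemma is_diff_sum (V W : normedModType R) n (f df : 'I_n -> V -> W) x :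
  (forall i, is_diff x (f i) (df i)) ->
  is_diff x (\sum_(i < n) f i) (\sum_(i < n) df i).
Proof.
elim: n f df => [|n ih] f df fdf; first by rewrite !big_ord0; exact: is_diff_cst.
rewrite !big_ord_recr /=; apply: is_diffD; exact: ih.
Qed.

End row_vectors.

(** * Euclidean product and monotone maps *)

Section dot.
Context {R : realType} {n : nat}.
Implicit Types u v : 'rV[R]_n.

(** The canonical norm of row vectors is the sup norm, which does not derive
    from an inner product; [sqr_norm_le_dot] and [dot_le_sqr_norm] compare it
    with the Euclidean one. *)
Definition dot u v : R := (u *m v^T) 0 0.

Lemma dotE u v : dot u v = \sum_i u 0 i * v 0 i.
Proof. by rewrite /dot mxE; apply: eq_bigr => i _; rewrite mxE. Qed.

Lemma dotC u v : dot u v = dot v u.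
Proof. by rewrite !dotE; apply: eq_bigr => i _; rewrite mulrC. Qed.

Lemma dotDl u v w : dot (u + v) w = dot u w + dot v w.
Proof. by rewrite /dot mulmxDl mxE. Qed.

Lemma dotZl a u w : dot (a *: u) w = a * dot u w.
Proof. by rewrite /dot -scalemxAl mxE. Qed.

Lemma dotDr u v w : dot w (u + v) = dot w u + dot w v.
Proof. by rewrite !(dotC w) dotDl. Qed.

Lemma dotZr a u w : dot w (a *: u) = a * dot w u.
Proof. by rewrite !(dotC w) dotZl. Qed.

Lemma dot0l u : dot 0 u = 0.
Proof. by rewrite /dot mul0mx mxE. Qed.

Lemma dot_delta u j : dot u (delta_mx 0 j) = u 0 j.
Proof.
rewrite dotE (bigD1 j) //= mxE !eqxx mulr1 big1 ?addr0 // => i ij.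
by rewrite mxE (negbTE ij) andbF mulr0.
Qed.

Lemma dotrr_ge0 u : 0 <= dot u u.
Proof. by rewrite dotE sumr_ge0 // => i _; rewrite -expr2 sqr_ge0. Qed.

Lemma coord_le_norm u i : `|u 0 i| <= `|u|.
Proof.
rewrite [leRHS]/Num.Def.normr /= mx_normrE; apply/bigmax_geP; right => /=.
by exists (ord0, i).
Qed.

Lemma sqr_norm_le_dot u : `|u| ^+ 2 <= dot u u.
Proof.
rewrite [`|u|]/Num.Def.normr /= mx_normrE.
have [->|] := eqVneq (\big[Num.max/0]_ij `|u ij.1 ij.2|) 0.
  by rewrite expr0n /= dotrr_ge0.
rewrite -mx_normrE => /mx_norm_neq0[[i j] -> /=]; rewrite ord1.
rewrite dotE (bigD1 j) //= real_normK ?num_real // expr2 lerDl.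
by rewrite sumr_ge0 // => k _; rewrite -expr2 sqr_ge0.
Qed.

Lemma dot_le_sqr_norm u : dot u u <= n%:R * `|u| ^+ 2.
Proof.
rewrite dotE mulr_natl -[leRHS]addr0.
have -> : `|u| ^+ 2 *+ n + 0 = \sum_(i < n) `|u| ^+ 2.
  by rewrite addr0 sumr_const card_ord.
apply: ler_sum => i _; rewrite -expr2 -real_normK ?num_real //.
by rewrite lerXn2r ?nnegrE // coord_le_norm.
Qed.

Lemma dotrr_eq0 u : (dot u u == 0) = (u == 0).
Proof.
apply/eqP/eqP => [u0|->]; last by rewrite dot0l.
apply/eqP; rewrite -normr_eq0 -sqrf_eq0; apply/eqP/le_anti.
by rewrite sqr_ge0 -u0 sqr_norm_le_dot.
Qed.

Lemma dot_CauchySchwarz u v : dot u v ^+ 2 <= dot u u * dot v v.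
Proof.
have [->|u0] := eqVneq u 0; first by rewrite !dot0l expr0n /= mul0r.
have uu : 0 < dot u u by rewrite lt0r dotrr_eq0 u0 dotrr_ge0.
have := dotrr_ge0 (dot u u *: v - dot u v *: u).
rewrite -scaleNr !(dotDl, dotDr, dotZl, dotZr) (dotC v u) => H.
rewrite -subr_ge0 -(pmulr_rge0 _ uu); apply: le_trans H _.
by rewrite le_eqVlt; apply/orP; left; apply/eqP; ring.
Qed.

End dot.

Lemma is_diff_dot (R : realType) (V : normedModType R) n
    (f g df dg : V -> 'rV[R]_n) x :
  is_diff x f df -> is_diff x g dg ->
  is_diff x (fun y => dot (f y) (g y))
    (fun k => dot (df k) (g x) + dot (f x) (dg k)).
Proof.
move=> fx gx.
have -> : (fun y => dot (f y) (g y)) =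
   \sum_(i < n) ((fun y => f y 0 i) * (fun y => g y 0 i)).
  by apply/funext => y; rewrite fct_sumE dotE.
have H i : is_diff x ((fun y => f y 0 i) * (fun y => g y 0 i))
    (f x 0 i *: (fun k => dg k 0 i) + g x 0 i *: (fun k => df k 0 i)).
  apply: is_diffM.
    exact: (is_diff_comp fx (is_diff_coord i (f x))).
  exact: (is_diff_comp gx (is_diff_coord i (g x))).
apply: is_diff_eq (is_diff_sum H) _.
apply/funext => k; rewrite fct_sumE !dotE -big_split; apply: eq_bigr => i _ /=.
by rewrite addrC [df k 0 i * _]mulrC.
Qed.

Section monotone.
Context {R : realType} {n : nat}.
Implicit Types (F : 'rV[R]_n -> 'rV[R]_n) (Om : set 'rV[R]_n).

Definition segment_closed Om := forall x y (t : R),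
  Om x -> Om y -> 0 <= t -> t <= 1 -> Om (x + t *: (y - x)).

(** If [F x = F y], then [t |-> (y - x) . F (x + t (y - x))] takes equal values
    at [0] and [1], although its derivative is positive. *)
Lemma monotone_injective F Om : segment_closed Om ->
  (forall x, Om x -> differentiable F x) ->
  (forall x k, Om x -> k != 0 -> 0 < dot k ('d F x k)) ->
  {in Om &, injective F}.
Proof.
move=> Omc dF dFp x y /set_mem Ox /set_mem Oy Fxy.
apply/eqP/negPn/negP => xy; pose k := y - x.
have k0 : k != 0 by rewrite subr_eq0 eq_sym.
pose g (t : R) := dot k (F (x + t *: k)).
have dg (t : R) : 0 <= t -> t <= 1 ->
    is_diff t g (fun s => dot k ('d F (x + t *: k) (s *: k))).
  move=> t0 t1; have /differentiableP Ft := dF _ (Omc _ _ _ Ox Oy t0 t1).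
  have lt : is_diff t (fun s : R => x + s *: k) (fun s => s *: k).
    apply: is_diff_eq (is_diffD (is_diff_cst x t) (is_diff_scalel t k)) _.
    by rewrite add0r.
  have := is_diff_dot (is_diff_cst k t) (is_diff_comp lt Ft) => H.
  by apply: is_diff_eq H _; apply/funext => s /=; rewrite dot0l add0r.
have [||c + H] := @MVT R g (fun t => dot k ('d F (x + t *: k) k)) 0 1 ltr01.
- move=> t; rewrite in_itv /= => /andP[/ltW t0 /ltW t1].
  have gt := dg t t0 t1; apply: DeriveDef.
    exact/derivable1_diffP.
  by rewrite deriveE // diff_val scale1r.
- apply: derivable_within_continuous => t; rewrite in_itv /= => /andP[t0 t1].
  by have gt := dg t t0 t1; exact/derivable1_diffP.
rewrite in_itv /= => /andP[/ltW c0 /ltW c1].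
have := dFp _ k (Omc _ _ _ Ox Oy c0 c1) k0; rewrite -/k.
move: H; rewrite subr0 mulr1 => <-.
by rewrite /g scale1r scale0r addr0 {2}/k subrKC Fxy subrr ltxx.
Qed.

End monotone.

(** * Local inversion *)

(** If [dg k < 0] for some direction [k], a small positive multiple of [k] makes
    [g] smaller than [g x]; apply this to [k] and [- k]. *)
Lemma diff_local_min (R : realType) (V : normedModType R) (g dg : V -> R) x :
  is_diff x g dg -> (\forall y \near x, g x <= g y) -> forall k, dg k = 0.
Proof.
move=> gx gmin.
have dgE : 'd g x = dg :> (V -> R) by exact: diff_val.
suff dg_ge0 k : 0 <= dg k.
  move=> k; apply/le_anti; rewrite dg_ge0 andbT -oppr_ge0 -dgE -linearN dgE.
  exact: dg_ge0.
rewrite leNgt; apply/negP => dgk.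
have kp : 0 < 2 * (`|k| + 1) by rewrite mulr_gt0 // ltr_wpDl.
have eps0 : 0 < - dg k / (2 * (`|k| + 1)) by rewrite divr_gt0 // oppr_gt0.
have : \forall y \near x, g x <= g y /\ `|g y - g x - 'd g x (y - x)| <=
    - dg k / (2 * (`|k| + 1)) * `|y - x|.
  by apply: filterI gmin _; exact: differentiable_approx.
rewrite [\forall y \near x, _](near_shift 0) subr0 => H.
have /nbhs_ballP[e /= e0 He] := near0Z k H.
have /He[] : ball 0 e (e / 2).
  by rewrite -ball_normE /= sub0r normrN gtr0_norm ?divr_gt0 // gtr_pMr // invf_lt1 // ltr1n.
rewrite /= addrK dgE => + /ler_normlW; rewrite -dgE linearZ /= dgE.
rewrite normrZ gtr0_norm ?divr_gt0 // => H1 H2.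
have H3 : - dg k / (2 * (`|k| + 1)) * (e / 2 * `|k|) <= e / 2 * (- dg k / 2).
  have -> : - dg k / (2 * (`|k| + 1)) * (e / 2 * `|k|) =
      e / 2 * (- dg k / 2) * (`|k| / (`|k| + 1)).
    by field; rewrite gt_eqF // ltr_wpDl.
  rewrite ger_pMr; last by rewrite !(mulr_gt0, oppr_gt0, invr_gt0).
  by rewrite ler_pdivrMr ?mul1r ?lerDl // ltr_wpDl.
have H4 : e / 2 * dg k < 0 by rewrite pmulr_rlt0 // divr_gt0.
have {}H2 : g ((e / 2) *: k + x) - g x - e / 2 * dg k <=
    - dg k / (2 * (`|k| + 1)) * (e / 2 * `|k|) by exact: H2.
have {}H3 : - dg k / (2 * (`|k| + 1)) * (e / 2 * `|k|) <= - (e / 2 * dg k) / 2.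
  by apply: le_trans H3 _; rewrite le_eqVlt; apply/orP; left; apply/eqP; ring.
move: H1 (le_trans H2 H3) H4; clear; lra.
Qed.

Section inverse.
Context {R : realType} {n : nat}.
Implicit Types (F G : 'rV[R]_n -> 'rV[R]_n) (Om : set 'rV[R]_n).

Lemma diff_injective_unitmx F x :
  (forall k, 'd F x k = 0 -> k = 0) -> 'J F x \in unitmx.
Proof.
move=> dFi; rewrite -row_free_unit; apply/inj_row_free => v.
by rewrite /jacobian mul_rV_lin1 => /dFi.
Qed.

(** If the differential [L] at [x] is invertible then
    [y - x = L^-1 (F y - F x) + o(y - x)], and the error term is absorbed by the
    left-hand side, whence the factor [2]. *)
Lemma differentiable_expansive F x : differentiable F x ->
  (forall k, 'd F x k = 0 -> k = 0) ->
  exists2 c, 0 < c & \forall y \near x, `|y - x| <= c * `|F y - F x|.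
Proof.
move=> dF dFi.
have Ju := diff_injective_unitmx dFi.
have [c c0 Hc] := linear_lipschitz
  (@linear_continuous_rV R n _ (mulmxr (invmx ('J F x)))).
exists (2 * c); first by rewrite mulr_gt0.
have e0 : 0 < (2 * c)^-1 by rewrite invr_gt0 mulr_gt0.
apply: filterS (differentiable_approx dF e0) => y H.
have := Hc ('d F x (y - x)).
rewrite -(mul_rV_lin1 ('d F x)) -/(jacobian F x) /= mulmxK // /jacobian mul_rV_lin1 => H1.
have : `|'d F x (y - x)| <= `|F y - F x| + (2 * c)^-1 * `|y - x|.
  rewrite -lerBlDl; apply: le_trans H.
  by rewrite [leRHS]distrC; exact: lerB_dist.
move=> /(ler_wpM2l (ltW c0))/(le_trans H1).
have -> : c * (`|F y - F x| + (2 * c)^-1 * `|y - x|) =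
    c * `|F y - F x| + `|y - x| / 2 by field; rewrite gt_eqF.
lra.
Qed.

(** The open mapping property, without continuity of the differential.  For [u]
    close to [F x], the squared Euclidean distance from [F y] to [u] has a minimum on a
    small closed ball around [x].  The minimum is not on the sphere, where
    [F y] stays away from [F x] by [differentiable_expansive].  At an interior
    minimum, the derivative in the direction that the differential of [F] sends
    to [F y - u] is [2 |F y - u| ^ 2], so [F y = u]. *)
Lemma local_surjectivity F Om x : open Om -> Om x ->
  (forall y, Om y -> differentiable F y) ->
  (forall y k, Om y -> 'd F y k = 0 -> k = 0) ->
  forall N, nbhs x N -> \forall u \near F x, exists2 y, N y & F y = u.
Proof.
move=> Omo Omx dF dFi N xN.
have [c c0 Hc] := differentiable_expansive (dF _ Omx) (fun k => dFi x k Omx).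
have xOm : nbhs x Om by exact: open_nbhs_nbhs.
have /nbhs_closedballP[r Hr] : \forall y \near x,
    [/\ N y, Om y & `|y - x| <= c * `|F y - F x|].
  by apply: filterS3 xN xOm Hc => y.
have r0 : 0 < r%:num by [].
rewrite closed_ballE // in Hr.
pose B : set 'rV[R]_n := closed_ball_ Num.Def.normr x r%:num.
have BOm y : B y -> Om y by move=> /Hr[].
have Bc : compact B.
  apply: bounded_closed_compact; last first.
    by rewrite /B -closed_ballE //; exact: closed_ball_closed.
  exists (`|x| + r%:num); split; first exact: num_real.
  move=> M HM y By; apply: ltW; apply: le_lt_trans HM.
  rewrite -[y](subrKC x); apply: le_trans (ler_normD _ _) _.
  by rewrite lerD2l distrC.
(* On the sphere [|F y - F x| >= (n + 2) del], so [|F y - u| >= (n + 1) del];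
   the squares differ by more than the factor [n] lost between the sup norm
   and the Euclidean one. *)
pose del := r%:num / (c * (n.+2)%:R).
have del0 : 0 < del by rewrite divr_gt0 // mulr_gt0.
have := nbhsx_ballx (F x) del del0; apply: filterS => u.
rewrite -ball_normE /= => ux.
pose g y := dot (F y - u) (F y - u).
have dg y : Om y -> is_diff y g
   (fun k => dot ('d F y k) (F y - u) + dot (F y - u) ('d F y k)).
  move=> Oy; have /differentiableP Fy := dF _ Oy.
  have H : is_diff y (fun y => F y - u) ('d F y).
    by apply: is_diff_eq (is_diffB Fy (is_diff_cst u y)) _; rewrite subr0.
  exact: is_diff_dot.
have [||y /set_mem By ymin] := @EVT_min_rV R n g B _ Bc.
- by exists x; rewrite /B /closed_ball_ /= subrr normr0.
- apply/continuous_in_subspaceT => z /set_mem Bz.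
  by have gz := dg z (BOm z Bz); exact: differentiable_continuous.
have [yr|yr] := ltP `|x - y| r%:num; last first.
  exfalso.
  have /Hr[_ _] := By.
  rewrite /= distrC => H1.
  have Hyx : n.+2%:R * del <= `|F y - F x|.
    rewrite -(ler_pM2l c0); apply: le_trans H1; apply: le_trans yr.
    by rewrite /del (mulrA c) mulrC divfK // mulf_neq0 ?pnatr_eq0 ?gt_eqF.
  have Hyu : n.+1%:R * del <= `|F y - u|.
    rewrite -(lerD2r del); apply: le_trans _ (lerD (lexx _) (ltW ux)).
    rewrite (distrC (F x)); apply: le_trans _ (ler_distD u (F y) (F x)).
    by apply: le_trans _ Hyx; rewrite -[n.+2]addn1 natrD mulrDl mul1r.
  have /ymin : x \in B by rewrite inE /B /closed_ball_ /= subrr normr0.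
  rewrite /g => gyx.
  have H2 := le_trans (sqr_norm_le_dot (F y - u)) gyx.
  have {}H2 := le_trans H2 (dot_le_sqr_norm (F x - u)).
  have H3 : (n.+1%:R * del) ^+ 2 <= `|F y - u| ^+ 2.
    by rewrite lerXn2r ?nnegrE // mulr_ge0 // ltW.
  have H4 : n%:R * `|F x - u| ^+ 2 <= n%:R * del ^+ 2.
    by rewrite ler_wpM2l // lerXn2r ?nnegrE // ltW.
  have := le_trans H3 (le_trans H2 H4).
  rewrite exprMn ler_pM2r ?exprn_gt0 // -natrX ler_nat.
  by rewrite leqNgt expnS expn1 mulSn ltn_addr.
exists y; first by have /Hr[] := By.
have Oy := BOm _ By.
have gy : \forall z \near y, g y <= g z.
  have : \forall z \near y, `|x - z| < r%:num.
    have := @open_nbhs_nbhs _ y (ball x r%:num).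
    rewrite -ball_normE; apply; split; last exact: yr.
    have := @ball_open R _ x r%:num; rewrite -ball_normE; exact.
  apply: filterS => z xz; apply: ymin.
  by rewrite inE /B /closed_ball_ /=; exact: ltW.
have := diff_local_min (dg y Oy) gy ((F y - u) *m invmx ('J F y)).
have Ju : 'J F y \in unitmx by apply: diff_injective_unitmx => k; exact: dFi.
rewrite -(mul_rV_lin1 ('d F y)) -/(jacobian F y) /= mulmxKV // -mulr2n => /eqP.
by rewrite mulrn_eq0 /= dotrr_eq0 subr_eq0 => /eqP.
Qed.

(** With [L] the differential of [F] at [G u], one has
    [G v - G u - L^-1 (v - u) = - L^-1 (F (G v) - F (G u) - L (G v - G u))].
    This is [o(G v - G u)] since [G] is continuous, and [G v - G u] is
    [O(v - u)] because [F] is expansive. *)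
Lemma is_diff_inverse F G u : {for u, continuous G} ->
  (\forall v \near u, F (G v) = v) -> differentiable F (G u) ->
  (forall k, 'd F (G u) k = 0 -> k = 0) ->
  is_diff u G (mulmxr (invmx ('J F (G u)))).
Proof.
move=> Gc FG dF dFi.
have Ju := diff_injective_unitmx dFi.
have Lc := @linear_continuous_rV R n _ (mulmxr (invmx ('J F (G u)))).
have [c c0 Hc] := differentiable_expansive dF dFi.
have [C C0 HC] := linear_lipschitz Lc.
apply: is_diff_approx => // eps eps0.
have e0 : 0 < eps / (C * c) by rewrite divr_gt0 // mulr_gt0.
have FGu := nbhs_singleton FG.
near=> v.
have FGv : F (G v) = v by near: v.
have H1 : `|G v - G u| <= c * `|v - u|.
  by rewrite -[in leRHS]FGv -[in leRHS]FGu; near: v; exact: (Gc _ Hc).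
have H2 : `|v - u - 'd F (G u) (G v - G u)| <= eps / (C * c) * `|G v - G u|.
  rewrite -{1}FGv -{1}FGu; near: v; exact: (Gc _ (differentiable_approx dF e0)).
have -> : G v - G u - mulmxr (invmx ('J F (G u))) (v - u) =
    - mulmxr (invmx ('J F (G u))) (v - u - 'd F (G u) (G v - G u)).
  rewrite [in RHS]linearB opprB; congr (_ - _) => /=.
  by rewrite -(mul_rV_lin1 ('d F (G u))) -/(jacobian F (G u)) mulmxK.
rewrite normrN; apply: le_trans (HC _) _.
apply: le_trans (ler_wpM2l (ltW C0) H2) _.
rewrite mulrA; apply: le_trans (ler_wpM2l _ H1) _.
  by rewrite mulr_ge0 // ltW.
rewrite le_eqVlt; apply/orP; left; apply/eqP.
by field; rewrite !gt_eqF.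
Unshelve. all: by end_near. Qed.

End inverse.

(** * Legendre transforms *)

(** The inverse [G] of [F] is differentiable, and differentiating
    [eta u = G u . u - phi (G u)] leaves [G u] as gradient: the two terms
    containing the differential of [G] cancel since [F] is the gradient of
    [phi].  The Hessian of [eta] is therefore the differential of [G], the
    inverse of a symmetric positive definite matrix.  Twice differentiability
    at [u] asks for the gradient formula in a whole neighbourhood, which is why
    the image has to be open. *)
Lemma legendre_strictly_convex (R : realType) n (Om : set 'rV[R]_n)
    (phi eta : 'rV[R]_n -> R) (F G : 'rV[R]_n -> 'rV[R]_n) :
  open Om -> segment_closed Om ->
  (forall x, Om x -> is_diff x phi (dot (F x))) ->
  (forall x, Om x -> differentiable F x) ->
  (forall x k l, Om x -> dot k ('d F x l) = dot l ('d F x k)) ->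
  (forall x k, Om x -> k != 0 -> 0 < dot k ('d F x k)) ->
  (forall u, (F @` Om) u -> Om (G u) /\ F (G u) = u) ->
  (forall u, (F @` Om) u -> eta u = dot (G u) u - phi (G u)) ->
  hessian_strictly_convex (F @` Om) eta.
Proof.
move=> Omo Omc phiF dF dFsym dFpos FG etaE.
have dFi x k : Om x -> 'd F x k = 0 -> k = 0.
  move=> Ox k0; apply/eqP/negPn/negP => /(dFpos x k Ox).
  by rewrite k0 dotC dot0l ltxx.
have Finj := monotone_injective Omc dF dFpos.
have FOmo u : (F @` Om) u -> \forall v \near u, (F @` Om) v.
  move=> -[x Ox <-].
  have xOm : nbhs x Om by exact: open_nbhs_nbhs.
  apply: filterS (local_surjectivity Omo Ox dF dFi xOm) => v [y Oy Fy].
  by exists y.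
have Gc u : (F @` Om) u -> {for u, continuous G}.
  move=> Vu N; have [OGu FGu] := FG u Vu => GuN.
  have NOm : nbhs (G u) (N `&` Om).
    by apply: filterI => //; exact: open_nbhs_nbhs.
  have := local_surjectivity Omo OGu dF dFi NOm; rewrite FGu.
  apply: filterS2 (FOmo u Vu) => v Vv [y [Ny Oy] Fy].
  have [OGv FGv] := FG v Vv.
  suff E : G v = y by move: Ny; rewrite -E.
  by apply: Finj; [exact: mem_set|exact: mem_set|rewrite FGv].
have dG u : (F @` Om) u -> is_diff u G (mulmxr (invmx ('J F (G u)))).
  move=> Vu; have [OGu _] := FG u Vu; apply: is_diff_inverse.
  - exact: Gc.
  - by apply: filterS (FOmo u Vu) => v /FG[].
  - exact: dF.
  - by move=> k; exact: dFi.
have Ju u : (F @` Om) u -> 'J F (G u) \in unitmx.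
  move=> Vu; have [OGu _] := FG u Vu.
  by apply: diff_injective_unitmx => k; exact: dFi.
have etaD u : (F @` Om) u -> is_diff u eta (dot (G u)).
  move=> Vu; have [OGu FGu] := FG u Vu.
  have [L GL] : exists L, is_diff u G L by exists (mulmxr (invmx ('J F (G u)))); exact: dG.
  have E : \forall v \near u, dot (G v) v - phi (G v) = eta v.
    by apply: filterS (FOmo u Vu) => v /etaE.
  apply: near_is_diff E _.
  have H := is_diffB (is_diff_dot GL (is_diff_id u)) (is_diff_comp GL (phiF _ OGu)).
  apply: is_diff_eq H _; apply/funext => k.
  rewrite [LHS](_ : _ = dot (L k) u + dot (G u) k - dot (F (G u)) (L k)) //.
  by rewrite FGu (dotC (L k)) addrAC subrr add0r.
have etaP j u : (F @` Om) u -> partial eta j u = G u 0 j.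
  move=> Vu; have H := etaD u Vu.
  by rewrite /partial deriveE // diff_val dot_delta.
move=> u Vu.
have GP j : \forall v \near u, G v 0 j = partial eta j v.
  by apply: filterS (FOmo u Vu) => v Vv; rewrite etaP.
have dGj j := is_diff_comp (dG u Vu) (is_diff_coord j (G u)).
have [OGu FGu] := FG u Vu.
have hE : hessian eta u = invmx ('J F (G u)).
  apply/matrixP => i j; rewrite mxE /partial -/(partial eta j).
  have H := dGj j.
  rewrite -(near_eq_derive _ (GP j)) deriveE; last exact: ex_diff.
  by rewrite diff_val /= -rowE mxE.
split; first split.
- by apply: filterS (FOmo u Vu) => v /etaD H; exact: ex_diff.
- by move=> j; have H := near_is_diff (GP j) (dGj j); exact: ex_diff.
rewrite hE; split.
  rewrite trmx_inv; congr invmx; apply/matrixP => i j.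
  have := dFsym _ (delta_mx 0 i) (delta_mx 0 j) OGu.
  by rewrite !(dotC (delta_mx _ _)) !dot_delta /jacobian !mxE.
move=> x x0.
(* the form of the inverse matrix at [x] is the form of the matrix at
   [x *m invmx ('J F (G u))] *)
have -> : (x *m invmx ('J F (G u)) *m x^T) 0 0 =
    dot (x *m invmx ('J F (G u))) ('d F (G u) (x *m invmx ('J F (G u)))).
  by rewrite -(mul_rV_lin1 ('d F (G u))) -/(jacobian F (G u)) mulmxKV ?Ju.
apply: dFpos => //; apply: contra_neq x0 => H.
by rewrite -(mulmxKV (Ju u Vu) x) H mul0mx.
Qed.

(** * Block decomposition of the state space *)

Section is_diff_tools.
Context {R : realType} {V : normedModType R}.

Lemma is_diff_comp1 (f : R -> R) (g dg : V -> R) a x :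
  is_derive (g x) 1 f a -> is_diff x g dg ->
  is_diff x (fun y => f (g y)) (fun k => a * dg k).
Proof.
move=> fa gx; have df : differentiable f (g x) by apply/derivable1_diffP.
have fx : is_diff (g x) f (fun h => a * h).
  apply: DiffDef => //; apply/funext => h.
  by rewrite deriv1E ?derive1E ?derive_val 1?mulrC //; exact/derivable1_diffP.
exact: (is_diff_comp gx fx).
Qed.

Lemma is_diff_scale n (k dk : V -> R) (f df : V -> 'rV[R]_n) x :
  is_diff x k dk -> is_diff x f df ->
  is_diff x (fun y => k y *: f y) (fun h => dk h *: f x + k x *: df h).
Proof.
move=> kx fx.
have H j : is_diff x (fun y => (k y *: f y) 0 j)
    (fun h => dk h * f x 0 j + k x * df h 0 j).
  have fj := is_diff_comp fx (is_diff_coord j (f x)).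
  rewrite (_ : (fun y => _) = k * ((fun u : 'rV[R]_n => u 0 j : R) \o f)); last first.
    by apply/funext => y; rewrite mxE.
  apply: is_diff_eq (is_diffM kx fj) _.
  by apply/funext => h; rewrite addrC [dk h * _]mulrC.
apply: is_diff_eq (is_diff_rV H) _.
by apply/funext => h; apply/rowP => j; rewrite !mxE.
Qed.

Lemma is_diff_row_mx n1 n2 (f df : V -> 'rV[R]_n1) (g dg : V -> 'rV[R]_n2) x :
  is_diff x f df -> is_diff x g dg ->
  is_diff x (fun y => row_mx (f y) (g y)) (fun k => row_mx (df k) (dg k)).
Proof.
move=> fx gx.
have H j : is_diff x (fun y => row_mx (f y) (g y) 0 j)
    (fun k => row_mx (df k) (dg k) 0 j).
  case: (split_ordP j) => i ->.
    have fj := is_diff_comp fx (is_diff_coord i (f x)).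
    rewrite (_ : (fun y => _) = (fun u : 'rV[R]_n1 => u 0 i : R) \o f).
      by apply: is_diff_eq fj _; apply/funext => k; rewrite row_mxEl.
    by apply/funext => y; rewrite row_mxEl.
  have gj := is_diff_comp gx (is_diff_coord i (g x)).
  rewrite (_ : (fun y => _) = (fun u : 'rV[R]_n2 => u 0 i : R) \o g).
    by apply: is_diff_eq gj _; apply/funext => k; rewrite row_mxEr.
  by apply/funext => y; rewrite row_mxEr.
apply: is_diff_eq (is_diff_rV H) _.
by apply/funext => h; apply/rowP => j; rewrite !mxE.
Qed.

Lemma is_diff_scalar_mx (f df : V -> R) x : is_diff x f df ->
  is_diff x (fun y => (f y)%:M : 'rV[R]_1) (fun k => (df k)%:M).
Proof.
move=> fx.
have H (j : 'I_1) : is_diff x (fun y => ((f y)%:M : 'rV[R]_1) 0 j) df.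
  by rewrite (_ : (fun y => _) = f) //; apply/funext => y; rewrite ord1 mxE mulr1n.
apply: is_diff_eq (is_diff_rV H) _.
by apply/funext => h; apply/rowP => j; rewrite !ord1 !mxE mulr1n.
Qed.

End is_diff_tools.

Section blocks.
Context {R : realType} {d : nat}.
Local Notation state := 'rV[R]_(1 + (d + 1)).
Implicit Types u v : state.

Definition mkstate (a : R) (m : 'rV[R]_d) (b : R) : state :=
  row_mx a%:M (row_mx m b%:M).
Definition fst_part u : R := u 0 (lshift (d + 1) 0).
Definition vec_part u : 'rV[R]_d := lsubmx (rsubmx u).
Definition lst_part u : R := u 0 (rshift 1 (rshift d 0)).

Lemma mkstateK u : mkstate (fst_part u) (vec_part u) (lst_part u) = u.
Proof.
apply/rowP => j; rewrite /mkstate /fst_part /vec_part /lst_part.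
case: (split_ordP j) => i ->; first by rewrite row_mxEl ord1 mxE mulr1n.
rewrite row_mxEr; case: (split_ordP i) => k ->; first by rewrite row_mxEl !mxE.
by rewrite row_mxEr ord1 mxE mulr1n.
Qed.

Lemma fst_mkstate a m b : fst_part (mkstate a m b) = a.
Proof. by rewrite /fst_part /mkstate row_mxEl mxE mulr1n. Qed.

Lemma vec_mkstate a m b : vec_part (mkstate a m b) = m.
Proof. by rewrite /vec_part /mkstate row_mxKr row_mxKl. Qed.

Lemma lst_mkstate a m b : lst_part (mkstate a m b) = b.
Proof. by rewrite /lst_part /mkstate !row_mxEr mxE mulr1n. Qed.

Lemma dot_mkstate a m b v :
  dot (mkstate a m b) v = a * fst_part v + dot m (vec_part v) + b * lst_part v.
Proof.
rewrite -[in LHS](mkstateK v) /mkstate /dot !tr_row_mx !mul_row_col !mxE -!addrA.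
by rewrite !big_ord1 !mxE !mulr1n.
Qed.

Lemma is_diff_fst u : is_diff u fst_part fst_part.
Proof. exact: is_diff_coord. Qed.

Lemma is_diff_lst u : is_diff u lst_part lst_part.
Proof. exact: is_diff_coord. Qed.

Lemma is_diff_vec u : is_diff u vec_part vec_part.
Proof.
have rx := is_diff_linear_rV (@rsubmx R 1 1 (d + 1)) u.
exact: (is_diff_comp rx (is_diff_linear_rV (@lsubmx R 1 d 1) (rsubmx u))).
Qed.

Lemma is_diff_mkstate (V : normedModType R) (f df h dh : V -> R)
    (g dg : V -> 'rV[R]_d) x :
  is_diff x f df -> is_diff x g dg -> is_diff x h dh ->
  is_diff x (fun y => mkstate (f y) (g y) (h y))
    (fun k => mkstate (df k) (dg k) (dh k)).
Proof.
move=> fx gx hx; apply: is_diff_row_mx; first exact: is_diff_scalar_mx.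
by apply: is_diff_row_mx => //; exact: is_diff_scalar_mx.
Qed.

End blocks.

(** * Positivity of the entropy form *)

(** Here [(b, b0)] is a timelike vector of Minkowski square [s] and [(be, be0)]
    a direction, with Minkowski product [sigma].  The direction is the sum of
    [sigma / s] times [(b, b0)] and of a spacelike vector orthogonal to it;
    [N] is the square of the latter with the sign that makes it nonnegative. *)
Section form.
Context {R : realType} {d : nat}.
Variables (b be : 'rV[R]_d) (b0 be0 s H A : R).

Let sigma := b0 * be0 - dot b be.
Let N := dot be be - be0 ^+ 2 + sigma ^+ 2 / s.

Hypotheses (sE : s = b0 ^+ 2 - dot b b) (s0 : 0 < s).

(** The Euclidean inequality for [b] and [be], rewritten with [N] and the time
    component [be0 - b0 * sigma / s] of the orthogonal part. *)
Lemma minkowski_CauchySchwarz :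
  s * (be0 - b0 * sigma / s) ^+ 2 <= N * dot b b.
Proof.
have bb : dot b b = b0 ^+ 2 - s by rewrite sE; ring.
have := dot_CauchySchwarz b be.
have -> : dot b be = b0 * be0 - sigma by rewrite /sigma; ring.
rewrite -subr_ge0 => CS; rewrite -subr_ge0; apply: le_trans CS _.
rewrite le_eqVlt; apply/orP; left; apply/eqP.
by rewrite /N bb; field; rewrite gt_eqF.
Qed.

Lemma minkowski_ge0 : 0 <= N.
Proof.
have [b_0|bn0] := eqVneq b 0.
  rewrite /N /sigma b_0 dot0l subr0.
  have -> : s = b0 ^+ 2 by rewrite sE b_0 dot0l subr0.
  rewrite exprMn mulrAC divff ?mul1r ?subrK ?dotrr_ge0 //.
  by apply: contraTneq s0 => b00; rewrite sE b_0 dot0l subr0 b00 ltxx.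
have bb : 0 < dot b b by rewrite lt0r dotrr_eq0 bn0 dotrr_ge0.
rewrite -(pmulr_lge0 _ bb); apply: le_trans minkowski_CauchySchwarz.
by rewrite mulr_ge0 ?sqr_ge0 // ltW.
Qed.

Hypotheses (b0_gt0 : 0 < b0) (Hs : 1 < H * s)
  (HA : 1 < (A * s ^+ 2 - H * s - 1) * (H * s - 1)).

(** Positive definiteness of the Hessian of the potential, divided by the
    pressure, in the direction [(k0, be, - be0)].  [X] and [Y] are the time
    components of the parts of [(be, be0)] along [(b, b0)] and orthogonal to
    it.  Times [b0], the form is a square containing [k0] plus
    [ep X ^ 2 - 2 X Y - Y ^ 2 + H b0 ^ 2 N].  By [minkowski_CauchySchwarz] the
    last term is at least [H s Y ^ 2 + H s N], so what remains is a binary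
    form in [X] and [Y] with coefficients [ep], [- 1] and [ka], of determinant
    [ep ka - 1 > 0].  For a fluid, [ep] is [e'] and [ka] is [h / theta - 1]. *)
Lemma entropy_form_eq0 (k0 : R) :
  b0 * (k0 - H * sigma) ^+ 2 + 2 * be0 * (k0 - H * sigma) + b0 * A * sigma ^+ 2
    + H * b0 * (dot be be - be0 ^+ 2) <= 0 ->
  [/\ k0 = 0, be = 0 & be0 = 0].
Proof.
set Q := (X in X <= 0) => Q0.
pose X := b0 * sigma / s; pose Y := be0 - X.
pose ep := A * s ^+ 2 - H * s - 1; pose ka := H * s - 1.
have ka0 : 0 < ka by rewrite subr_gt0.
have ep0 : 0 < ep by rewrite -(pmulr_lgt0 _ ka0); apply: lt_trans HA.
have H0 : 0 < H by rewrite -(pmulr_lgt0 _ s0); apply: lt_trans Hs.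
have N0 := minkowski_ge0.
have NY : s * Y ^+ 2 + s * N <= b0 ^+ 2 * N.
  have := minkowski_CauchySchwarz; rewrite -/X -/Y.
  have -> : dot b b = b0 ^+ 2 - s by rewrite sE; ring.
  lra.
have QE : b0 * Q = (b0 * (k0 - H * sigma) + be0) ^+ 2 +
    (ep * X ^+ 2 - 2 * X * Y - Y ^+ 2 + H * (b0 ^+ 2 * N)).
  by rewrite /Q /ep /Y /X /N; field; rewrite gt_eqF.
(* completing the square in [X] after multiplication by [ep] *)
have form_ge : (ep * X - Y) ^+ 2 + (ep * ka - 1) * Y ^+ 2 + ep * (H * s * N) <=
    ep * (ep * X ^+ 2 - 2 * X * Y - Y ^+ 2 + H * (b0 ^+ 2 * N)).
  have -> : (ep * X - Y) ^+ 2 + (ep * ka - 1) * Y ^+ 2 + ep * (H * s * N) =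
     ep * (ep * X ^+ 2 - 2 * X * Y - Y ^+ 2 + H * (s * Y ^+ 2 + s * N)).
    by rewrite /ka; ring.
  by rewrite (ler_pM2l ep0) lerD2l (ler_pM2l H0).
have bQ : b0 * Q <= 0 by rewrite pmulr_rle0.
have epka : 0 < ep * ka - 1 by rewrite subr_gt0.
have t1 : 0 <= (ep * X - Y) ^+ 2 by exact: sqr_ge0.
have t2 : 0 <= (ep * ka - 1) * Y ^+ 2 by rewrite mulr_ge0 ?sqr_ge0 // ltW.
have t3 : 0 <= ep * (H * s * N).
  by rewrite mulr_ge0 ?(ltW ep0) // mulr_ge0 // mulr_ge0 // ltW.
have t0 : 0 <= (b0 * (k0 - H * sigma) + be0) ^+ 2 by exact: sqr_ge0.
have tT : ep * (ep * X ^+ 2 - 2 * X * Y - Y ^+ 2 + H * (b0 ^+ 2 * N)) <= 0.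
  rewrite pmulr_rle0 //; move: bQ; rewrite QE; move: t0; clear; lra.
have z2 : (ep * ka - 1) * Y ^+ 2 = 0.
  by apply/le_anti; rewrite t2 andbT; move: t1 t3 tT form_ge; clear; lra.
have z1 : (ep * X - Y) ^+ 2 = 0.
  by apply/le_anti; rewrite t1 andbT; move: t2 t3 tT form_ge; clear; lra.
have z3 : ep * (H * s * N) = 0.
  by apply/le_anti; rewrite t3 andbT; move: t1 t2 tT form_ge; clear; lra.
have Y0 : Y = 0.
  by move/eqP: z2; rewrite mulf_eq0 gt_eqF // expf_eq0 /= => /eqP.
have X0 : X = 0.
  by move/eqP: z1; rewrite Y0 subr0 expf_eq0 mulf_eq0 gt_eqF //= => /eqP.
have be00 : be0 = 0 by move: Y0; rewrite /Y X0 subr0.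
have sig0 : sigma = 0.
  move/eqP: X0; rewrite /X !mulf_eq0 invr_eq0 (gt_eqF s0) (gt_eqF b0_gt0) orbF.
  by move/eqP.
have be_0 : be = 0.
  move/eqP: z3; rewrite !mulf_eq0 (gt_eqF ep0) (gt_eqF H0) (gt_eqF s0) /= /N be00 sig0 expr0n /= mul0r.
  by rewrite subr0 addr0 dotrr_eq0 => /eqP.
split=> //; move: Q0; rewrite /Q sig0 be00 be_0 dot0l expr0n /=.
rewrite !(mulr0, mul0r, subr0, addr0) => k0Q.
apply/eqP; rewrite -sqrf_eq0; apply/eqP/le_anti; rewrite sqr_ge0 andbT.
by move: k0Q; rewrite pmulr_rle0.
Qed.

End form.

(** * The potential on the forward light cone *)

Section cone.
Context {R : realType} {d : nat}.
Local Notation state := 'rV[R]_(1 + (d + 1)).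
Implicit Types u v : state.

(** The last entropy variable is [- gamma / theta]; with the sign changed it is
    the time component of a future-directed vector. *)
Definition time_part u : R := - lst_part u.
Definition lorentz_sqr u : R := time_part u ^+ 2 - dot (vec_part u) (vec_part u).
Definition lorentz_dot u v : R :=
  time_part u * time_part v - dot (vec_part u) (vec_part v).
Definition cone : set state := [set u | 0 < time_part u /\ 0 < lorentz_sqr u].

Lemma is_diff_time u : is_diff u time_part time_part.
Proof. exact: is_diff_eq (is_diffN (is_diff_lst u)) _. Qed.

Lemma is_diff_lorentz_sqr u : is_diff u lorentz_sqr (fun k => 2 * lorentz_dot u k).
Proof.
have H := is_diffB (is_diffM (is_diff_time u) (is_diff_time u))
  (is_diff_dot (is_diff_vec u) (is_diff_vec u)).
have -> : lorentz_sqr = time_part * time_part - (fun y => dot (vec_part y) (vec_part y)).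
  by apply/funext => y; rewrite /lorentz_sqr expr2.
apply: is_diff_eq H _; apply/funext => k.
rewrite [LHS](_ : _ = time_part u * time_part k + time_part u * time_part k -
  (dot (vec_part k) (vec_part u) + dot (vec_part u) (vec_part k))) //.
by rewrite (dotC (vec_part k)) /lorentz_dot; ring.
Qed.

Lemma cone_open : open cone.
Proof.
have -> : cone = (time_part @^-1` [set x | 0 < x]) `&` (lorentz_sqr @^-1` [set x | 0 < x]).
  by [].
apply: openI; apply: open_comp; try exact: open_gt.
  by move=> u _; have H := is_diff_time u; exact: differentiable_continuous.
by move=> u _; have H := is_diff_lorentz_sqr u; exact: differentiable_continuous.
Qed.

Lemma time_partD u v : time_part (u + v) = time_part u + time_part v.
Proof. by rewrite /time_part /lst_part mxE opprD. Qed.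
Lemma time_partZ a u : time_part (a *: u) = a * time_part u.
Proof. by rewrite /time_part /lst_part mxE mulrN. Qed.
Lemma vec_partD u v : vec_part (u + v) = vec_part u + vec_part v.
Proof. by rewrite /vec_part !linearD. Qed.
Lemma vec_partZ a u : vec_part (a *: u) = a *: vec_part u.
Proof. by rewrite /vec_part !linearZ. Qed.

Lemma conic_comb_gt0 (a c x y : R) : 0 <= a -> 0 <= c -> 0 < a + c ->
  0 < x -> 0 < y -> 0 < a * x + c * y.
Proof.
move=> a0 c0 ac x0 y0; have m0 : 0 < Num.min x y by rewrite lt_min x0.
apply: lt_le_trans (mulr_gt0 ac m0) _.
by rewrite mulrDl lerD // ler_wpM2l // ge_min lexx ?orbT.
Qed.

(** The square of [a u + c v] is [a ^ 2 u ^ 2 + c ^ 2 v ^ 2 + 2 a c u . v], and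
    the product of two future-directed timelike vectors is nonnegative by
    Cauchy-Schwarz. *)
Lemma cone_comb (a c : R) u v : cone u -> cone v -> 0 <= a -> 0 <= c ->
  0 < a + c -> cone (a *: u + c *: v).
Proof.
move=> [u0 su] [v0 sv] a0 c0 ac.
have uv : 0 <= lorentz_dot u v.
  rewrite subr_ge0; apply: le_trans (ler_norm _) _.
  rewrite -ler_sqr ?nnegrE ?mulr_ge0 ?(ltW u0) ?(ltW v0) //.
  rewrite real_normK ?num_real //; apply: le_trans (dot_CauchySchwarz _ _) _.
  by rewrite exprMn ler_pM ?dotrr_ge0 // -subr_ge0 ltW.
split; first by rewrite time_partD !time_partZ conic_comb_gt0.
rewrite /lorentz_sqr time_partD vec_partD !time_partZ !vec_partZ.
rewrite !(dotDl, dotDr, dotZl, dotZr) (dotC (vec_part v) (vec_part u)).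
rewrite (_ : _ - _ = a ^+ 2 * lorentz_sqr u + c ^+ 2 * lorentz_sqr v + 2 * (a * c) * lorentz_dot u v).
  rewrite ltr_wpDr ?mulr_ge0 // conic_comb_gt0 ?sqr_ge0 //.
  rewrite lt0r addr_ge0 ?sqr_ge0 // andbT paddr_eq0 ?sqr_ge0 // !expf_eq0 /=.
  by apply: contraTN ac => /andP[/eqP -> /eqP ->]; rewrite addr0 ltxx.
by rewrite /lorentz_sqr /lorentz_dot; ring.
Qed.

Lemma cone_segment : segment_closed cone.
Proof.
move=> u v t Ou Ov t0 t1.
have -> : u + t *: (v - u) = (1 - t) *: u + t *: v.
  by rewrite scalerBr scalerBl scale1r addrAC addrA.
by apply: cone_comb; rewrite ?subr_ge0 ?subrK.
Qed.

End cone.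

(** [logp] is the part of the logarithm of the pressure that depends on the
    temperature only, as a function of [s = theta ^ (- 2)].  Its derivative is
    governed by [H = theta * h] and that of [H] by [A], so the equation of state
    enters only through these two derivatives. *)
Section potential.
Context {R : realType} {d : nat}.
Local Notation state := 'rV[R]_(1 + (d + 1)).
Implicit Types u k : state.
Variables logp H A : R -> R.
Hypothesis logpD : forall s : R, 0 < s -> is_derive s (1 : R) logp (- H s / 2).
Hypothesis HD : forall s : R, 0 < s -> is_derive s (1 : R) H (- A s / 2).

Definition pressure u : R := expR (fst_part u + logp (lorentz_sqr u)).
Definition potential u : R := time_part u * pressure u.
Definition potential_grad u : state :=
  mkstate (potential u) ((potential u * H (lorentz_sqr u)) *: vec_part u)
    (pressure u * (H (lorentz_sqr u) * time_part u ^+ 2 - 1)).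

Let dpressure u k : R := pressure u * (fst_part k - H (lorentz_sqr u) * lorentz_dot u k).
Let dheat u k : R := - A (lorentz_sqr u) * lorentz_dot u k.
Let dpotential u k : R := time_part k * pressure u + time_part u * dpressure u k.
Let dgrad u k : state :=
  mkstate (dpotential u k)
    ((dpotential u k * H (lorentz_sqr u) + potential u * dheat u k) *: vec_part u
     + (potential u * H (lorentz_sqr u)) *: vec_part k)
    (dpressure u k * (H (lorentz_sqr u) * time_part u ^+ 2 - 1) + pressure u *
     (dheat u k * time_part u ^+ 2 + H (lorentz_sqr u) * (2 * time_part u * time_part k))).

Lemma is_diff_pressure u : cone u -> is_diff u pressure (dpressure u).
Proof.
move=> [_ su].
have h1 := is_diff_comp1 (logpD su) (is_diff_lorentz_sqr u).
have h2 := is_diffD (is_diff_fst u) h1.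
have h3 := is_diff_comp1 (is_derive_expR _) h2.
apply: is_diff_eq h3 _; apply/funext => k.
rewrite [LHS](_ : _ = pressure u * (fst_part k + - H (lorentz_sqr u) / 2 * (2 * lorentz_dot u k))) //.
by rewrite /dpressure; field.
Qed.

Lemma is_diff_H u : cone u -> is_diff u (fun v => H (lorentz_sqr v)) (dheat u).
Proof.
move=> [_ su].
have h1 := is_diff_comp1 (HD su) (is_diff_lorentz_sqr u).
by apply: is_diff_eq h1 _; apply/funext => k; rewrite /dheat; field.
Qed.

Lemma is_diff_potential_expl u : cone u -> is_diff u potential (dpotential u).
Proof.
move=> cu.
have h := is_diffM (is_diff_time u) (is_diff_pressure cu).
apply: is_diff_eq h _; apply/funext => k.
rewrite [LHS](_ : _ = time_part u * dpressure u k + pressure u * time_part k) //.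
by rewrite /dpotential; ring.
Qed.

(** The gradient of the density in the entropy variables is the vector of
    conserved quantities. *)
Lemma is_diff_potential u : cone u -> is_diff u potential (dot (potential_grad u)).
Proof.
move=> cu; apply: is_diff_eq (is_diff_potential_expl cu) _; apply/funext => k.
rewrite dot_mkstate dotZl /dpotential /dpressure /potential /lorentz_dot.
have -> : lst_part k = - time_part k by rewrite /time_part opprK.
ring.
Qed.

Lemma is_diff_potential_grad u : cone u -> is_diff u potential_grad (dgrad u).
Proof.
move=> cu.
have hp := is_diff_potential_expl cu; have hH := is_diff_H cu.
have h1 : is_diff u (fun v => potential v * H (lorentz_sqr v))
    (fun k => dpotential u k * H (lorentz_sqr u) + potential u * dheat u k).
  apply: is_diff_eq (is_diffM hp hH) _; apply/funext => k.
  rewrite [LHS](_ : _ = potential u * dheat u k + H (lorentz_sqr u) * dpotential u k) //; ring.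
have h2 := is_diff_scale h1 (is_diff_vec u).
have ht : is_diff u (fun v => time_part v ^+ 2) (fun k => 2 * time_part u * time_part k).
  have h := is_diffM (is_diff_time u) (is_diff_time u).
  apply: is_diff_eq h _; apply/funext => k.
  rewrite [LHS](_ : _ = time_part u * time_part k + time_part u * time_part k) //; ring.
have h3 : is_diff u (fun v => H (lorentz_sqr v) * time_part v ^+ 2 - 1) (fun k =>
    dheat u k * time_part u ^+ 2 + H (lorentz_sqr u) * (2 * time_part u * time_part k)).
  have h := is_diffB (is_diffM hH ht) (is_diff_cst (1 : R) u).
  apply: is_diff_eq h _; apply/funext => k.
  rewrite [LHS](_ : _ = H (lorentz_sqr u) * (2 * time_part u * time_part k) +
     time_part u ^+ 2 * dheat u k - 0) //; ring.
have h4 : is_diff u (fun v => pressure v * (H (lorentz_sqr v) * time_part v ^+ 2 - 1)) (fun k =>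
   dpressure u k * (H (lorentz_sqr u) * time_part u ^+ 2 - 1) + pressure u *
     (dheat u k * time_part u ^+ 2 + H (lorentz_sqr u) * (2 * time_part u * time_part k))).
  have h := is_diffM (is_diff_pressure cu) h3.
  apply: is_diff_eq h _; apply/funext => k.
  rewrite [LHS](_ : _ = pressure u *
     (dheat u k * time_part u ^+ 2 + H (lorentz_sqr u) * (2 * time_part u * time_part k)) +
      (H (lorentz_sqr u) * time_part u ^+ 2 - 1) * dpressure u k) //; ring.
exact: is_diff_mkstate.
Qed.

(** Written symmetrically in [k] and [l], so that the symmetry of the Hessian
    of the potential is visible, and for [k = l] it is the form of
    [entropy_form_eq0]. *)
Lemma dot_dgrad u k l : dot l (dgrad u k) = pressure u *
  (time_part u * (fst_part k - H (lorentz_sqr u) * lorentz_dot u k) * (fst_part l - H (lorentz_sqr u) * lorentz_dot u l)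
   + time_part l * (fst_part k - H (lorentz_sqr u) * lorentz_dot u k)
   + time_part k * (fst_part l - H (lorentz_sqr u) * lorentz_dot u l)
   + time_part u * A (lorentz_sqr u) * lorentz_dot u k * lorentz_dot u l
   + H (lorentz_sqr u) * time_part u * (dot (vec_part k) (vec_part l) - time_part k * time_part l)).
Proof.
rewrite dotC dot_mkstate dotDl !dotZl.
have -> : lst_part l = - time_part l by rewrite /time_part opprK.
by rewrite /dpotential /dheat /dpressure /potential /lorentz_dot; ring.
Qed.

Lemma diff_potential_grad_sym u k l : cone u ->
  dot k ('d potential_grad u l) = dot l ('d potential_grad u k).
Proof.
move=> cu; have h := is_diff_potential_grad cu; rewrite diff_val !dot_dgrad.
by rewrite (dotC (vec_part k)); ring.
Qed.

(** For a fluid, these say [h / theta > 1] and [e' * (h / theta - 1) > 1]. *)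
Hypothesis Hs : forall s : R, 0 < s -> 1 < H s * s.
Hypothesis HA : forall s : R, 0 < s ->
  1 < (A s * s ^+ 2 - H s * s - 1) * (H s * s - 1).

Lemma diff_potential_grad_posdef u k : cone u -> k != 0 ->
  0 < dot k ('d potential_grad u k).
Proof.
move=> cu k0; have h := is_diff_potential_grad cu; rewrite diff_val !dot_dgrad.
have [u0 su] := cu.
rewrite pmulr_rgt0 ?expR_gt0 // ltNge; apply/negP => Q0.
have [|k1 k2 k3] := @entropy_form_eq0 R d (vec_part u) (vec_part k)
   (time_part u) (time_part k) (lorentz_sqr u) (H (lorentz_sqr u)) (A (lorentz_sqr u)) erefl su u0
   (Hs su) (HA su) (fst_part k).
  apply: le_trans Q0; rewrite /lorentz_dot le_eqVlt; apply/orP; left; apply/eqP; ring.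
case/eqP: k0; rewrite -(mkstateK k) k1 k2.
have -> : lst_part k = 0 by rewrite -[LHS]opprK -/(time_part k) k3 oppr0.
by apply/rowP => j; rewrite /mkstate !raddf0 !row_mx0 mxE.
Qed.

End potential.

(** * The equation of state *)

Section eos.
Context {R : realType}.
Variables e Ie : R -> R.
Hypothesis e_derivable : forall t : R, 0 < t -> derivable e t 1.
Hypothesis Ie_antiderivative : forall t : R, 0 < t ->
  is_derive t (1 : R) Ie (derive1 e t / t).
Hypothesis e'_gt0 : forall t : R, 0 < t -> 0 < derive1 e t.
Hypothesis h_gt : forall t : R, 0 < t ->
  t * (1 + derive1 e t) / derive1 e t < enthalpy e t.

(** The suffix [_sqr] marks functions of the Minkowski square
    [s = theta ^ (- 2)] of the entropy variables; [temp] recovers [theta]. *)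
Definition temp (s : R) : R := (Num.sqrt s)^-1.
Definition log_pressure (t : R) : R := Ie t - enthalpy e t / t + ln t.
Definition log_pressure_sqr (s : R) : R := log_pressure (temp s).
Definition heat (t : R) : R := t * enthalpy e t.
Definition heat_sqr (s : R) : R := heat (temp s).
Definition heat_slope (s : R) : R :=
  temp s ^+ 3 * (enthalpy e (temp s) + temp s * (1 + derive1 e (temp s))).

Lemma temp_gt0 s : 0 < s -> 0 < temp s.
Proof. by move=> s0; rewrite invr_gt0 sqrtr_gt0. Qed.

Lemma is_derive_temp (s : R) : 0 < s -> is_derive s (1 : R) temp (- temp s ^+ 3 / 2).
Proof.
move=> s0; have q0 : Num.sqrt s != 0 by rewrite gt_eqF // sqrtr_gt0.
apply: (is_derive_eq (is_deriveV q0 (is_derive1_sqrt s0))).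
by rewrite /temp /GRing.scale /=; field.
Qed.

Lemma is_derive_enthalpy (t : R) : 0 < t ->
  is_derive t (1 : R) (enthalpy e) (1 + derive1 e t).
Proof.
move=> t0; have de : is_derive t (1 : R) e (derive1 e t).
  by rewrite derive1E; exact/derivableP/e_derivable.
have h : is_derive t (1 : R) (enthalpy e) (0 + derive1 e t + 1).
  exact: (is_deriveD (is_deriveD (is_derive_cst (1 : R) t (1 : R)) de)
    (is_derive_id t (1 : R))).
by apply: (is_derive_eq h); ring.
Qed.

Lemma is_derive_heat (t : R) : 0 < t ->
  is_derive t (1 : R) heat (enthalpy e t + t * (1 + derive1 e t)).
Proof.
move=> t0.
apply: (is_derive_eq (is_deriveM (is_derive_id t (1 : R)) (is_derive_enthalpy t0))).
by rewrite /GRing.scale /=; ring.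
Qed.

Lemma is_derive_log_pressure (t : R) : 0 < t ->
  is_derive t (1 : R) log_pressure (enthalpy e t / t ^+ 2).
Proof.
move=> t0; have tn0 : t != 0 by rewrite gt_eqF.
have h := is_deriveD (is_deriveB (Ie_antiderivative t0)
  (is_deriveM (is_derive_enthalpy t0) (is_deriveV tn0 (is_derive_id t (1 : R)))))
  (is_derive1_ln t0).
apply: (is_derive_eq h).
by rewrite /GRing.scale /=; field.
Qed.

Lemma is_derive_log_pressure_sqr (s : R) : 0 < s -> is_derive s (1 : R) log_pressure_sqr (- heat_sqr s / 2).
Proof.
move=> s0; have t0 := temp_gt0 s0.
apply: (is_derive_eq (is_derive1_comp (is_derive_log_pressure t0) (is_derive_temp s0))).
by rewrite /heat_sqr /heat; field; rewrite gt_eqF.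
Qed.

Lemma is_derive_heat_sqr (s : R) : 0 < s -> is_derive s (1 : R) heat_sqr (- heat_slope s / 2).
Proof.
move=> s0; have t0 := temp_gt0 s0.
apply: (is_derive_eq (is_derive1_comp (is_derive_heat t0) (is_derive_temp s0))).
by rewrite /heat_slope; ring.
Qed.

Lemma temp_sqr (s : R) : 0 < s -> s = temp s ^- 2.
Proof. by move=> s0; rewrite /temp exprVn invrK sqr_sqrtr // ltW. Qed.

Lemma heat_sqr_mul (s : R) : 0 < s -> heat_sqr s * s = enthalpy e (temp s) / temp s.
Proof.
move=> s0; have t0 := temp_gt0 s0.
by rewrite {2}(temp_sqr s0) /heat_sqr /heat; field; rewrite gt_eqF.
Qed.

(** The coefficient [ep] of the entropy form is exactly [e'], the enthalpy
    terms cancelling. *)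
Lemma heat_slope_mul (s : R) : 0 < s ->
  heat_slope s * s ^+ 2 - heat_sqr s * s - 1 = derive1 e (temp s).
Proof.
move=> s0; have t0 := temp_gt0 s0.
rewrite heat_sqr_mul // {2}(temp_sqr s0) /heat_slope; field; rewrite gt_eqF //.
Qed.

Lemma enthalpy_gap (t : R) : 0 < t ->
  1 < derive1 e t * (enthalpy e t / t - 1).
Proof.
move=> t0; have e0 := e'_gt0 t0.
have := h_gt t0; rewrite ltr_pdivrMr // => h.
rewrite -subr_gt0.
have -> : derive1 e t * (enthalpy e t / t - 1) - 1 =
    (enthalpy e t * derive1 e t - t * (1 + derive1 e t)) / t.
  by field; rewrite gt_eqF.
by rewrite divr_gt0 // subr_gt0.
Qed.

Lemma heat_sqr_mul_gt1 (s : R) : 0 < s -> 1 < heat_sqr s * s.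
Proof.
move=> s0; have t0 := temp_gt0 s0; rewrite heat_sqr_mul // -subr_gt0.
rewrite -(pmulr_rgt0 _ (e'_gt0 t0)).
by apply: lt_trans (enthalpy_gap t0).
Qed.

Lemma heat_slope_gap (s : R) : 0 < s ->
  1 < (heat_slope s * s ^+ 2 - heat_sqr s * s - 1) * (heat_sqr s * s - 1).
Proof.
by move=> s0; rewrite heat_slope_mul // heat_sqr_mul //; exact/enthalpy_gap/temp_gt0.
Qed.

End eos.

(** * Entropy variables of a fluid state *)

Section rhd.
Context {R : realType} {d : nat}.
Variables e Ie : R -> R.
Local Notation prim := (@prim R d).
Local Notation state := 'rV[R]_(1 + (d + 1)).
Implicit Types w : prim.

Definition entropy_var w : state :=
  mkstate (enthalpy e (theta w) / theta w - entropyS Ie w)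
    ((lorentz w / theta w) *: vel w) (- (lorentz w / theta w)).

Lemma sqr_eucl_norm (v : 'rV[R]_d) : eucl_norm v ^+ 2 = dot v v.
Proof.
rewrite /eucl_norm sqr_sqrtr; last by rewrite sumr_ge0 // => i _; rewrite sqr_ge0.
by rewrite dotE; apply: eq_bigr => i _; rewrite expr2.
Qed.

Lemma eucl_norm_lt1 (v : 'rV[R]_d) : (eucl_norm v < 1) = (dot v v < 1).
Proof. by rewrite -sqr_eucl_norm expr_lt1 // sqrtr_ge0. Qed.

Section admissible.
Variable w : prim.
Hypothesis aw : admissible w.

Let rho0 : 0 < rho w. Proof. by case: aw. Qed.
Let th0 : 0 < theta w. Proof. by case: aw. Qed.
Let v1 : 0 < 1 - dot (vel w) (vel w).
Proof. by case: aw => _ _; rewrite eucl_norm_lt1 subr_gt0. Qed.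

Lemma prsE : prs w = theta w * rho w.
Proof. by rewrite /theta divfK // gt_eqF. Qed.

Lemma lorentz_gt0 : 0 < lorentz w.
Proof. by rewrite invr_gt0 sqrtr_gt0 sqr_eucl_norm. Qed.

Lemma sqr_lorentz : lorentz w ^+ 2 * (1 - dot (vel w) (vel w)) = 1.
Proof.
rewrite /lorentz exprVn sqr_eucl_norm sqr_sqrtr ?ltW //.
by rewrite mulVf // gt_eqF.
Qed.

Lemma time_entropy_var : time_part (entropy_var w) = lorentz w / theta w.
Proof. by rewrite /time_part lst_mkstate opprK. Qed.

Lemma lorentz_sqr_entropy_var : lorentz_sqr (entropy_var w) = theta w ^- 2.
Proof.
rewrite /lorentz_sqr time_entropy_var vec_mkstate dotZl dotZr.
rewrite (_ : _ - _ = lorentz w ^+ 2 * (1 - dot (vel w) (vel w)) / theta w ^+ 2).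
  by rewrite sqr_lorentz mul1r.
by field; rewrite gt_eqF.
Qed.

Lemma entropy_var_cone : cone (entropy_var w).
Proof.
split; first by rewrite time_entropy_var divr_gt0 // lorentz_gt0.
by rewrite lorentz_sqr_entropy_var invr_gt0 exprn_gt0.
Qed.

Lemma temp_entropy_var : temp (lorentz_sqr (entropy_var w)) = theta w.
Proof.
by rewrite lorentz_sqr_entropy_var /temp -exprVn sqrtr_sqr gtr0_norm ?invrK // invr_gt0.
Qed.

Lemma pressure_entropy_var : pressure (log_pressure_sqr e Ie) (entropy_var w) = prs w.
Proof.
rewrite /pressure /log_pressure_sqr temp_entropy_var fst_mkstate /entropyS /log_pressure prsE.
rewrite (_ : _ + _ = ln (theta w) + ln (rho w)); last by ring.
by rewrite expRD !lnK // posrE.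
Qed.

(** Since [p = theta * rho], the potential [b0 * p = gamma / theta * p] is the
    density [D = rho * gamma]. *)
Lemma potential_entropy_var : potential (log_pressure_sqr e Ie) (entropy_var w) = cons_D w.
Proof.
rewrite /potential pressure_entropy_var time_entropy_var prsE /cons_D.
by field; rewrite gt_eqF.
Qed.

Lemma potential_grad_entropy_var :
  potential_grad (log_pressure_sqr e Ie) (heat_sqr e) (entropy_var w) = cons e w.
Proof.
rewrite /potential_grad potential_entropy_var pressure_entropy_var time_entropy_var /heat_sqr.
rewrite temp_entropy_var vec_mkstate scalerA /heat.
rewrite /cons -/(mkstate _ _ _) /cons_m /cons_E /cons_D.
congr mkstate; first by congr (_ *: _); field; rewrite gt_eqF.
by rewrite prsE; field; rewrite gt_eqF.
Qed.

(** The thermodynamic identity behind the duality.  Replacing [|v| ^ 2] by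
    [1 - gamma ^ (- 2)], the momentum and energy terms of [W . U] add up to
    [D - D * h / theta]; the term [w0 * D = D * h / theta - D * S] then leaves
    [D - D * S], and the potential is [D]. *)
Lemma legendre_entropy_var :
  - (cons_D w * entropyS Ie w) =
  dot (entropy_var w) (cons e w) - potential (log_pressure_sqr e Ie) (entropy_var w).
Proof.
rewrite potential_entropy_var dot_mkstate dotZl /cons -/(mkstate _ _ _).
rewrite fst_mkstate vec_mkstate lst_mkstate /cons_m dotZr /cons_E /cons_D prsE.
have g0 := lorentz_gt0.
have -> : dot (vel w) (vel w) = 1 - lorentz w ^- 2.
  have g2 : lorentz w ^+ 2 != 0 by rewrite expf_neq0 // gt_eqF.
  suff -> : lorentz w ^- 2 = 1 - dot (vel w) (vel w) by rewrite subKr.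
  by apply: (mulfI g2); rewrite sqr_lorentz divff.
by field; rewrite !gt_eqF.
Qed.

End admissible.

(** The inverse change of variables: [theta] is read off the Minkowski square,
    the velocity is the slope [b / b0], and [w0] then determines the pressure. *)
Lemma cone_entropy_var (u : state) : cone u ->
  exists2 w, admissible w & entropy_var w = u.
Proof.
move=> [b0 s0].
have t0 := temp_gt0 s0.
pose t := temp (lorentz_sqr u); pose p := pressure (log_pressure_sqr e Ie) u.
have p0 : 0 < p by exact: expR_gt0.
pose w : prim := (p / t, (time_part u)^-1 *: vec_part u, p).
have rw : rho w = p / t by [].
have vw : vel w = (time_part u)^-1 *: vec_part u by [].
have pw : prs w = p by [].
have tw : theta w = t.
  by rewrite /theta rw pw; field; rewrite !gt_eqF.
have v1 : 1 - dot (vel w) (vel w) = lorentz_sqr u / time_part u ^+ 2.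
  by rewrite vw dotZl dotZr /lorentz_sqr; field; rewrite gt_eqF.
have lw : lorentz w = time_part u * t.
  rewrite /lorentz sqr_eucl_norm v1 -exprVn sqrtrM ?ltW //.
  by rewrite sqrtr_sqr gtr0_norm ?invr_gt0 // invfM invrK mulrC.
exists w.
  rewrite /admissible /=; split; rewrite ?tw ?rw ?divr_gt0 //.
  by rewrite eucl_norm_lt1 -subr_gt0 v1 divr_gt0 // exprn_gt0.
have tn0 : t != 0 by rewrite gt_eqF.
have bt : lorentz w / theta w = time_part u by rewrite lw tw mulfK.
rewrite /entropy_var bt tw vw scalerA divff ?gt_eqF // scale1r /entropyS.
rewrite -[RHS]mkstateK; congr mkstate; last by rewrite opprK.
rewrite rw tw ln_div ?posrE // /p /pressure expRK /log_pressure_sqr /log_pressure -/t.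
ring.
Qed.

End rhd.

Theorem theorem2 (R : realType) (d : nat) (d_range : (1 <= d <= 3)%N)
    (e Ie : R -> R)
    (e_derivable : forall t : R, 0 < t -> derivable e t 1)
    (e_C1 : forall t : R, 0 < t -> {for t, continuous (derive1 e)})
    (Ie_antiderivative :
      forall t : R, 0 < t -> is_derive t (1 : R) Ie (derive1 e t / t))
    (e'_gt0 : forall t : R, 0 < t -> 0 < derive1 e t)
    (h_gt : forall t : R, 0 < t ->
      t * (1 + derive1 e t) / derive1 e t < enthalpy e t) :
  hessian_strictly_convex (consG d e) (eta d e Ie).
Proof.
pose F : 'rV[R]_(1 + (d + 1)) -> _ := potential_grad (log_pressure_sqr e Ie) (heat_sqr e).
have log_pressureD := is_derive_log_pressure_sqr e_derivable Ie_antiderivative.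
have heatD := is_derive_heat_sqr e_derivable.
have GE : consG d e = F @` cone.
  apply/seteqP; split => [u [w aw <-]|u [x cx <-]].
    exists (entropy_var e Ie w); first exact: entropy_var_cone.
    exact: potential_grad_entropy_var.
  have [w aw <-] := cone_entropy_var e Ie cx; exists w => //.
  by rewrite /F potential_grad_entropy_var.
have primP u : consG d e u -> admissible (prim_of e u) /\ cons e (prim_of e u) = u.
  move=> Gu; split; last by apply: pinvK; exact: mem_set.
  have sj : set_surj admissible (consG d e) (cons e) by [].
  by apply: (surjpinv_image_sub (dflt := fun=> point) sj); exists u.
rewrite GE; apply: (@legendre_strictly_convex R _ cone (potential (log_pressure_sqr e Ie)) _ F
  (fun u => entropy_var e Ie (prim_of e u))).
- exact: cone_open.
- exact: cone_segment.
- by move=> x; exact: is_diff_potential.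
- move=> x cx; have h := is_diff_potential_grad log_pressureD heatD cx; exact: ex_diff.
- by move=> x k l; exact: (diff_potential_grad_sym log_pressureD heatD).
- move=> x k; apply: (diff_potential_grad_posdef log_pressureD heatD).
    exact: heat_sqr_mul_gt1.
  exact: heat_slope_gap.
- rewrite -GE => u /primP[au uE]; split; first exact: entropy_var_cone.
  by rewrite /F potential_grad_entropy_var.
- rewrite -GE => u /primP[au uE].
  by rewrite /eta (legendre_entropy_var e Ie au) uE.
Qed.
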